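(* For every real $x$ with $0\le x\le \tfrac14\pi$, $$\int_0^x \log(\tan\theta)\,d\theta = x\log(\tan x) - \frac14\sum_{k=0}^\infty \frac{(2\sin 2x)^{2k+1}}{(2k+1)^2\binom{2k}{k}}.$$
   Context: The integrand has an integrable logarithmic singularity at $\theta=0$. At $x=0$ the expression $x\log(\tan x)$ is understood as its limiting value $0$. *)

(* Defs.v *)
From mathcomp Require Export all_boot all_order all_algebra.
From mathcomp Require Export all_classical all_reals all_analysis.

Set Implicit Arguments.
Unset Strict Implicit.
Unset Printing Implicit Defensive.

Export Order.TTheory GRing.Theory Num.Theory.
Export numFieldNormedType.Exports.

(* The integral of log (tan theta) over [0, x] is the Lebesgue integral.  The
   library's ln is total, with ln y = 0 for y <= 0: this only affects the
   integrand on the null set {0}.  Likewise x * ln (tan x) is 0 at x = 0, which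
   is its limiting value there. *)
Definition logtan_term (R : realType) (x : R) (k : nat) : R :=
  ((2 * sin (2 * x)) ^+ (2 * k + 1) /
    ((2 * k + 1)%:R ^+ 2 * 'C(2 * k, k)%:R))%R.

(* Main.v *)
Require Import Defs.
From mathcomp Require Import all_boot all_order all_algebra.
From mathcomp Require Import all_classical all_reals all_analysis.
From mathcomp Require Import measurable_realfun ring lra zify.

(** Write s = sin 2x, c = cos 2x, w_k = 4^k / 'C(2k, k), S_n for the n-th
    partial sum of the series and
    G_n = c * sum_(k < n) w_k / (2k + 1) * s^(2k + 1).
    The terms of the series are 2 w_k / (2k + 1)^2 * s^(2k + 1), hence
    S_n' = 4 G_n / s.  In the limit G_n is c * arcsin s / sqrt (1 - s^2) = 2x,
    so that the right-hand side x ln tan x - S / 4 has derivative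
    ln tan x + 2x / s - 2x / s = ln tan x and vanishes at 0.

    The proof makes this argument quantitative at a finite n, so that neither
    the arcsine series nor the termwise differentiation of a series, which would
    be delicate at the endpoint x = pi / 4 where s = 1, is needed.  Because
    w_(k+1) = (2k + 2) / (2k + 1) * w_k, the derivative of G_n telescopes:
    G_n' = 2 (1 - w_n s^(2n)) (is_derive_angle_sum).
    Consider
      U_n = x ln tan x - S_n / 4,
      L_n = G_n / 2 * ln tan x - S_n / 4 - w_n s^(2n) / (4n).
    Since G_n <= 2x, one gets U_n' = ln tan x + (2x - G_n) / s >= ln tan x.
    In L_n the replacement of x by G_n / 2 cancels the error term
    (2x - G_n) / s, which is not uniformly small near pi / 4, and leaves
    L_n' = ln tan x - w_n s^(2n - 1) (c + s ln tan x); this is at most ln tan x,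
    because - ln tan x <= cot 2x (oppr_ln_tan_le_cot2).
    As L_n <= 0 and U_n tends to 0 at 0, integration gives
      L_n <= int_0^x ln tan <= U_n,
    where the left inequality also yields the integrability.  Finally
    U_n - L_n <= w_n / (4n), and w_n^2 <= 4n makes this tend to 0: hence S_n
    converges to 4 (x ln tan x - int_0^x ln tan). *)

Set Implicit Arguments.
Unset Strict Implicit.
Unset Printing Implicit Defensive.

Local Open Scope classical_set_scope.
Local Open Scope ring_scope.

(** * Comparing an integral with the increment of a function *)

Lemma segment_integrable (R : realType) (f : R -> R) (a b : R) :
    {in `[a, b], forall t : R, {for t, continuous f}} ->
  (@lebesgue_measure R).-integrable `[a, b] (EFin \o f).
Proof.
move=> cf; apply: continuous_compact_integrable; first exact: segment_compact.
by apply: continuous_in_subspaceT => t; rewrite inE => /cf.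
Qed.

(** The difference of y |-> int_a^y f and F has a nonnegative derivative. *)
Lemma increment_le_Rintegral (R : realType) (f F dF : R -> R) (a b : R) :
    a <= b ->
    {in `[a, b], forall t : R, {for t, continuous f}} ->
    {in `[a, b], forall t : R, is_derive t 1 F (dF t)} ->
    {in `[a, b], forall t : R, dF t <= f t} ->
  F b - F a <= \int[@lebesgue_measure R]_(t in `[a, b]) f t.
Proof.
move=> ab cf F' dFf; have fi := segment_integrable cf.
pose A y := \int[@lebesgue_measure R]_(t in `[a, y]) f t.
suff : A a - F a <= A b - F b.
  by rewrite /A set_itv1 Rintegral_set1; lra.
have ooW t : t \in `]a, b[ -> t \in `[a, b] by exact: subset_itv_oo_cc.
have A' t : t \in `]a, b[ -> derivable A t 1 /\ derive1 A t = f t.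
  move=> tab; move: (tab); rewrite in_itv/= => /andP[at_ tb].
  apply: (continuous_FTC1_closed tb _ at_ (cf _ (ooW _ tab))).
  by apply: integrableS fi => //; apply: subset_itvl; rewrite bnd_simp ltW.
apply: (@ger0_derive1_ndecr _ (A \- F) a b) => //.
- move=> t tab; apply: derivableB; first exact: (A' _ tab).1.
  by have [] := F' _ (ooW _ tab).
- move=> t tab; have [dA A't] := A' _ tab; have [dFt F't] := F' _ (ooW _ tab).
  by rewrite derive1E deriveB// -derive1E A't F't subr_ge0 dFf// ooW.
- move=> t; apply: continuousB; first exact: parameterized_integral_continuous.
  apply: continuous_in_subspaceT => {}t; rewrite inE => /F'[dFt _].
  exact/differentiable_continuous/derivable1_diffP.
Qed.

Lemma Rintegral_le_increment (R : realType) (f F dF : R -> R) (a b : R) :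
    a <= b ->
    {in `[a, b], forall t : R, {for t, continuous f}} ->
    {in `[a, b], forall t : R, is_derive t 1 F (dF t)} ->
    {in `[a, b], forall t : R, f t <= dF t} ->
  \int[@lebesgue_measure R]_(t in `[a, b]) f t <= F b - F a.
Proof.
move=> ab cf F' fdF.
have IN : \int[@lebesgue_measure R]_(t in `[a, b]) (- f t) =
    - \int[@lebesgue_measure R]_(t in `[a, b]) f t.
  rewrite -mulN1r -RintegralZl//; last exact: segment_integrable.
  by apply: eq_Rintegral => t _; rewrite mulN1r.
suff : - F b - - F a <= \int[@lebesgue_measure R]_(t in `[a, b]) (- f t).
  by rewrite IN -opprD lerN2.
apply: (@increment_le_Rintegral _ (\- f) (\- F) (\- dF)) => // t tab.
- by apply: continuousN; exact: cf.
- by have ? := F' _ tab; exact: is_deriveN.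
- by rewrite lerN2 fdF.
Qed.

(** Integrability is a conclusion: by monotone convergence the integral over
    [0, x] is the limit of those over [x / (n + 1), x], and each of these is at
    most F x - F (x / (n + 1)) <= F x. *)
Lemma improper_Rintegral_le (R : realType) (f F dF : R -> R) (x : R) :
    0 < x ->
    {in `]0, x], forall t : R, {for t, continuous f}} ->
    {in `]0, x], forall t : R, 0 <= f t} ->
    {in `]0, x], forall t : R, is_derive t 1 F (dF t)} ->
    {in `]0, x], forall t : R, f t <= dF t} ->
    {in `]0, x], forall t : R, 0 <= F t} ->
  (@lebesgue_measure R).-integrable `[0, x] (EFin \o f) /\
  \int[@lebesgue_measure R]_(t in `[0, x]) f t <= F x.
Proof.
move=> x0 cf f0 F' fdF F0; set mu := @lebesgue_measure R.
have subI e : 0 < e -> {subset `[e, x] <= `]0, x]}.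
  by move=> e0; apply: subset_itvr; rewrite bnd_simp.
pose D n : set R := `[x / n.+1%:R, x]%classic.
have xn0 n : 0 < x / n.+1%:R by rewrite divr_gt0.
have bigD : \bigcup_n D n = `]0, x]%classic.
  apply/seteqP; split=> t /=.
    by move=> [n _]; exact: subI.
  rewrite in_itv/= => /andP[t0 tx].
  have tx0 : 0 < t / x by rewrite divr_gt0.
  have [n] := ltr_add_invr tx0; rewrite add0r => nt.
  exists n => //; rewrite /D /= in_itv/= tx andbT mulrC -ler_pdivlMr//.
  exact: ltW.
have fD n : mu.-integrable (D n) (EFin \o f).
  by apply: segment_integrable => t tD; apply: cf; exact: subI tD.
have mf n : measurable_fun (D n) (EFin \o f).
  exact: measurable_int (fD n).
have mf' : measurable_fun `]0, x] (EFin \o f).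
  by rewrite -bigD; apply/measurable_fun_bigcup => // i; exact: measurable_itv.
have cvgI : (\int[mu]_(t in D i) (f t)%:E @[i --> \oo] -->
    \int[mu]_(t in `[0%R, x]) (f t)%:E)%E.
  rewrite -integral_itv_obnd_cbnd// -bigD.
  apply: ge0_nondecreasing_set_cvg_integral => //.
  - move=> m n mn; rewrite subsetEset; apply: subset_itvr; rewrite bnd_simp.
    by rewrite ler_pM2l// lef_pV2 ?posrE ?ltr0n// ler_nat ltnS.
  - by move=> i; exact: measurable_itv.
  - by move=> i t Dt; rewrite lee_fin f0//; exact: subI Dt.
have intle : (\int[mu]_(t in `[0%R, x]) (f t)%:E <= (F x)%:E)%E.
  apply: (cvge_to_le cvgI); apply: nearW => n.
  rewrite -(fineK (integrable_fin_num _ (fD n))) ?lee_fin//; last first.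
    exact: measurable_itv.
  have xnx : x / n.+1%:R <= x by rewrite ler_pdivrMr// ler_peMr ?ler1n// ltW.
  have := @Rintegral_le_increment _ f F dF _ _ xnx.
  move=> /(_ (sub_in1 (subI _ (xn0 n)) cf) (sub_in1 (subI _ (xn0 n)) F')).
  move=> /(_ (sub_in1 (subI _ (xn0 n)) fdF)) /le_trans; apply.
  by rewrite gerBl F0// in_itv/= xn0.
have If0 : (0 <= \int[mu]_(t in `]0%R, x]) (f t)%:E)%E.
  by apply: integral_ge0 => t xt; rewrite lee_fin f0.
rewrite -integral_itv_obnd_cbnd// in intle.
split; last first.
  rewrite /Rintegral -integral_itv_obnd_cbnd// -lee_fin fineK//.
  by rewrite ge0_fin_numE// (le_lt_trans intle) ?ltry.
apply/integrableP; split; first exact/emeasurable_fun_itv_obnd_cbndP.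
rewrite -integral_itv_obnd_cbnd; last exact: measurableT_comp.
under eq_integral => t /[!inE] tx do rewrite /= ger0_norm ?f0//.
by rewrite (le_lt_trans intle) ?ltry.
Qed.

(** For every e in ]0, x], F x - F e is at most the integral over [e, x], hence
    at most the integral over [0, x]; let e tend to 0. *)
Lemma le_improper_Rintegral (R : realType) (f F dF : R -> R) (x : R) :
    0 < x ->
    (@lebesgue_measure R).-integrable `[0, x] (EFin \o f) ->
    {in `]0, x], forall t : R, {for t, continuous f}} ->
    {in `[0, x], forall t : R, 0 <= f t} ->
    {in `]0, x], forall t : R, is_derive t 1 F (dF t)} ->
    {in `]0, x], forall t : R, dF t <= f t} ->
    F t @[t --> 0^'+] --> 0 ->
  F x <= \int[@lebesgue_measure R]_(t in `[0, x]) f t.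
Proof.
move=> x0 fi cf f0 F' dFf F0; set I := Rintegral _ _ _.
have Fe : F x - F t @[t --> 0^'+] --> F x - 0 by apply: cvgB => //; exact: cvg_cst.
rewrite -[F x]subr0; apply: (cvgr_to_le Fe); near=> e.
have e0 : 0 < e by [].
have ex : e <= x by near: e; exact: nbhs_right_le.
have subI : {subset `[e, x] <= `]0, x]} by apply: subset_itvr; rewrite bnd_simp.
apply: le_trans (increment_le_Rintegral ex (sub_in1 subI cf) (sub_in1 subI F')
  (sub_in1 subI dFf)) _.
have sub : `[e, x]%classic `<=` `[0, x]%classic.
  by apply: subset_itvr; rewrite bnd_simp ltW.
rewrite /I /Rintegral fine_le//.
- by apply: integrable_fin_num => //; exact: integrableS fi.
- exact: integrable_fin_num.
- by apply: ge0_subset_integral => //; exact: measurable_int fi.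
Unshelve. all: end_near. Qed.

(** * The coefficients 4^n / 'C(2n, n) *)

Definition central_ratio (R : realType) (n : nat) : R :=
  4 ^+ n / 'C(2 * n, n)%:R.

Lemma central_ratio_gt0 (R : realType) (n : nat) : 0 < central_ratio R n.
Proof. by rewrite divr_gt0 ?exprn_gt0// ltr0n bin_gt0 leq_pmull. Qed.

(** This is (n + 1) 'C(2n + 2, n + 1) = 2 (2n + 1) 'C(2n, n); it is what makes
    the derivative of [angle_sum] telescope. *)
Lemma central_ratioS (R : realType) (n : nat) :
  (2 * n + 1)%:R * central_ratio R n.+1 = (2 * n + 2)%:R * central_ratio R n.
Proof.
have binS : (n.+1 * 'C(2 * n.+1, n.+1) = (2 * (2 * n + 1)) * 'C(2 * n, n))%N.
  have h1 := mul_bin_diag (2 * n.+1) n.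
  have h2 := mul_bin_down (2 * n).+1 n.
  have e : (2 * n.+1 = (2 * n).+2)%N by lia.
  rewrite -h1 e /=.
  have -> : ((2 * n).+2 = 2 * n.+1)%N by lia.
  have e2 : ((2 * n).+1 - n = n.+1)%N by lia.
  rewrite -mulnA; move: h2; rewrite e2 /= => h2; nia.
have b0 m : 'C(2 * m, m)%:R != 0 :> R.
  by rewrite pnatr_eq0 -lt0n bin_gt0 leq_pmull.
have := congr1 (fun m : nat => m%:R : R) binS; rewrite !natrM => binR.
have n0 : n.+1%:R != 0 :> R by rewrite pnatr_eq0.
rewrite /central_ratio exprS.
have -> : 'C(2 * n.+1, n.+1)%:R =
    2 * (2 * n + 1)%:R * 'C(2 * n, n)%:R / n.+1%:R :> R.
  by rewrite -binR mulrAC divff// mul1r.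
have -> : (2 * n + 2)%:R = 2 * n.+1%:R :> R by rewrite -natrM; congr _%:R; lia.
by field; rewrite b0 nat1r n0 -natrM natr1 pnatr_eq0.
Qed.

(** Induction on n + 1, the step being 4 m (m + 1) <= (2m + 1)^2.  The true
    size is sqrt (pi n), so this crude bound has the right order. *)
Lemma central_ratio_sqr_le (R : realType) (n : nat) :
  central_ratio R n.+1 ^+ 2 <= 4 * n.+1%:R.
Proof.
elim: n => [|n IH].
  by rewrite /central_ratio bin1 expr1 mulr1; lra.
have h := central_ratioS R n.+1.
have w0 := central_ratio_gt0 R n.+1.
have w1 := central_ratio_gt0 R n.+2.
move: h IH w0 w1.
move: (central_ratio R n.+1) (central_ratio R n.+2) => w v.
rewrite !natrD !natrM -[n.+2%:R]natr1.
have : 0 < n.+1%:R :> R by rewrite ltr0n.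
move: (n.+1%:R : R) => m m0 h IH w0 v0.
have c0 : 0 < (2 * m + 1) ^+ 2 by nra.
rewrite -(ler_pM2l c0) -exprMn h exprMn.
have : (2 * m + 2) ^+ 2 * w ^+ 2 <= (2 * m + 2) ^+ 2 * (4 * m).
  by rewrite ler_pM2l//; nra.
move=> /le_trans; apply; nra.
Qed.

Lemma central_ratio_cvg0 (R : realType) :
  central_ratio R n.+1 / n.+1%:R @[n --> \oo] --> 0.
Proof.
have c : 2 * Num.sqrt (n.+1%:R^-1 : R) @[n --> \oo] --> 0.
  rewrite -[X in _ --> X](_ : 2 * Num.sqrt 0 = 0); last by rewrite sqrtr0 mulr0.
  apply: cvgM; first exact: cvg_cst.
  apply: (@cvg_comp _ _ _ (@harmonic R) Num.sqrt); first exact: cvg_harmonic.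
  exact: sqrt_continuous.
apply: (squeeze_cvgr _ (cvg_cst 0) c); apply: nearW => n.
have w0 := central_ratio_gt0 R n.+1; have n0 : 0 < n.+1%:R :> R by rewrite ltr0n.
rewrite divr_ge0 ?(ltW w0)//=.
rewrite -(@ler_pXn2r _ 2) ?nnegrE ?divr_ge0 ?mulr_ge0 ?(ltW w0) ?sqrtr_ge0//.
rewrite exprMn [leRHS]exprMn sqr_sqrtr ?invr_ge0// exprVn.
have -> : 2 ^+ 2 / n.+1%:R = 4 * n.+1%:R * (n.+1%:R ^+ 2)^-1 :> R.
  by move: (n.+1%:R : R) (lt0r_neq0 n0) => m m0; field.
by rewrite ler_wpM2r ?invr_ge0 ?exprn_ge0// central_ratio_sqr_le.
Qed.

(** * Derivatives of the partial sums *)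

Lemma is_derive_sin2 (R : realType) (x : R) :
  is_derive x 1 (fun t => sin (2 * t)) (2 * cos (2 * x)).
Proof.
have -> : (fun t : R => sin (2 * t)) = sin \o (2 *: id) by apply/funext.
by apply: is_derive_eq; rewrite /= -[2 *: 1]/(2 * 1) mulr1 mulrC.
Qed.

Lemma is_derive_cos2 (R : realType) (x : R) :
  is_derive x 1 (fun t => cos (2 * t)) (- 2 * sin (2 * x)).
Proof.
have -> : (fun t : R => cos (2 * t)) = cos \o (2 *: id) by apply/funext.
by apply: is_derive_eq; rewrite /= -[2 *: 1]/(2 * 1) mulr1
  -[(2 *: id) x]/(2 * x); lra.
Qed.

Lemma is_derive_sin2X (R : realType) (n : nat) (x : R) :
  is_derive x 1 (fun t => sin (2 * t) ^+ n)
    (2 * n%:R * cos (2 * x) * sin (2 * x) ^+ n.-1).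
Proof.
have ? := is_derive_sin2 x.
have -> : (fun t : R => sin (2 * t) ^+ n) = (fun t => sin (2 * t)) ^+ n.
  by apply/funext => t; rewrite fctE.
apply: is_derive_eq; rewrite -mulr_natr /GRing.scale /=.
by case: n => [|n] /=; ring.
Qed.

(** The sum is the expansion of arcsin s / sqrt (1 - s^2) at s = sin 2x; the
    factor cos 2x = sqrt (1 - s^2) turns its limit into the angle 2x. *)
Definition angle_sum (R : realType) (n : nat) (x : R) : R :=
  cos (2 * x) * \sum_(0 <= k < n)
    central_ratio R k / (2 * k + 1)%:R * sin (2 * x) ^+ (2 * k + 1).

Lemma logtan_termE (R : realType) (x : R) (k : nat) :
  logtan_term x k =
  2 * (central_ratio R k / (2 * k + 1)%:R ^+ 2) * sin (2 * x) ^+ (2 * k + 1).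
Proof.
rewrite /logtan_term /central_ratio exprMn exprD exprM expr1 invfM.
have -> : (2 : R) ^+ 2 = 4 by lra.
by ring.
Qed.

Lemma is_derive_logtan_series (R : realType) (n : nat) (x : R) :
  sin (2 * x) != 0 ->
  is_derive x 1 (fun t => series (logtan_term t) n)
    (4 * angle_sum n x / sin (2 * x)).
Proof.
move=> s0.
elim: n => [|n IH].
  have -> : (fun t : R => series (logtan_term t) 0) = cst 0.
    by apply/funext => t; rewrite /series /= big_geq.
  by apply: is_derive_eq; rewrite /angle_sum big_geq// !mulr0 mul0r.
have -> : (fun t : R => series (logtan_term t) n.+1) =
    (fun t => series (logtan_term t) n) +
    (2 * (central_ratio R n / (2 * n + 1)%:R ^+ 2)) *:
      (fun t => sin (2 * t) ^+ (2 * n + 1)).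
  by apply/funext => t; rewrite !fctE /series /= big_nat_recr//= logtan_termE.
have ? := is_derive_sin2X (2 * n + 1) x.
apply: is_derive_eq; rewrite /GRing.scale /= /angle_sum big_nat_recr//=.
rewrite addn1 /= -[(2 * n).+1%:R]natr1 [in RHS]exprS.
have : (2 * n)%:R + 1 != 0 :> R by rewrite natr1 pnatr_eq0.
move=> n0; field; exact/andP.
Qed.

(** With c^2 = 1 - s^2 the k-th summand contributes
    2 (w_k s^(2k) - w_(k+1) s^(2k+2)), since
    w_(k+1) = (2k + 2) / (2k + 1) * w_k. *)
Lemma is_derive_angle_sum (R : realType) (n : nat) (x : R) :
  is_derive x 1 (angle_sum n)
    (2 * (1 - central_ratio R n * sin (2 * x) ^+ (2 * n))).
Proof.
elim: n => [|n IH].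
  have -> : @angle_sum R 0 = cst 0.
    by apply/funext => t; rewrite /angle_sum big_geq// mulr0.
  apply: is_derive_eq.
  by rewrite /central_ratio muln0 bin0 !expr0; lra.
have -> : @angle_sum R n.+1 = angle_sum n +
    (central_ratio R n / (2 * n + 1)%:R) *:
      ((fun t => cos (2 * t)) * (fun t => sin (2 * t) ^+ (2 * n + 1))).
  apply/funext => t; rewrite !fctE /angle_sum big_nat_recr//= mulrDr.
  by congr +%R; rewrite /GRing.scale /=; ring.
have ? := is_derive_sin2X (2 * n + 1) x.
have ? := is_derive_cos2 x.
apply: is_derive_eq; rewrite /GRing.scale /= .
have n0 : (2 * n + 1)%:R != 0 :> R by rewrite addn1 pnatr_eq0.
have -> : central_ratio R n.+1 =
    (2 * n + 2)%:R * central_ratio R n / (2 * n + 1)%:R.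
  by rewrite -central_ratioS mulrAC divff// mul1r.
have -> : (2 * n.+1 = (2 * n).+2)%N by lia.
have -> : (2 * n + 2)%:R = (2 * n + 1)%:R + 1 :> R by rewrite natr1 addn1 addn2.
rewrite addn1 /= in n0 *.
have c2 := cos2sin2 (2 * x).
have -> c m S : c * (2 * m * c * S) = 2 * m * S * c ^+ 2 :> R by ring.
by rewrite c2 !exprS; move: ((2 * n).+1%:R : R) n0 => m m0; field.
Qed.

(** * Inequalities on ]0, pi / 4] *)

Lemma quarter_bounds (R : realType) (t : R) : 0 <= t -> t <= pi / 4 ->
  [/\ t < pi / 2, - (pi / 2) < t & - (pi / 2) <= 2 * t <= pi / 2].
Proof. by move: (pi : R) (pi_gt0 R) => p p0 t0 t4; split; lra. Qed.

Lemma sin_cos_quarter (R : realType) (t : R) : 0 < t -> t <= pi / 4 ->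
  [/\ 0 < sin t, 0 < cos t, sin t <= cos t, 0 < sin (2 * t) & 0 <= cos (2 * t)].
Proof.
move=> t0 t4; have [t2 tN2 t22] := quarter_bounds (ltW t0) t4.
have s0 : 0 < sin t by apply: sin_gt0_pihalf; rewrite t0.
have c0 : 0 < cos t by apply: cos_gt0_pihalf; rewrite t2 tN2.
have s20 : 0 < sin (2 * t) by rewrite mulr_natl sin_mulr2n mulrn_wgt0// mulr_gt0.
have c20 : 0 <= cos (2 * t) by exact: cos_ge0_pihalf.
split=> //; rewrite -(@ler_pXn2r _ 2) ?nnegrE ?(ltW s0) ?(ltW c0)//.
move: c20 (sin2cos2 t); rewrite [2 * t]mulr_natl cos_mulr2n.
move: (sin t ^+ 2) (cos t ^+ 2) => a b; lra.
Qed.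

Lemma tan_quarter (R : realType) (t : R) :
  0 < t -> t <= pi / 4 -> 0 < tan t <= 1.
Proof.
move=> t0 t4; have [s0 c0 sc _ _] := sin_cos_quarter t0 t4.
by rewrite /tan divr_gt0//= ler_pdivrMr// mul1r.
Qed.

Lemma is_derive_ln_tan (R : realType) (t : R) : 0 < t -> t <= pi / 4 ->
  is_derive t 1 (@ln R \o tan) (2 / sin (2 * t)).
Proof.
move=> t0 t4; have [s0 c0 _ _ _] := sin_cos_quarter t0 t4.
have /andP[tan0 _] := tan_quarter t0 t4.
have ? := is_derive1_ln tan0.
have ? := is_derive_tan (lt0r_neq0 c0).
apply: is_derive_eq.
rewrite [2 * t]mulr_natl sin_mulr2n /tan -mulr_natr.
by field; rewrite !lt0r_neq0.
Qed.

Lemma ln_tan_continuous (R : realType) (t : R) : 0 < t -> t <= pi / 4 ->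
  {for t, continuous (fun u => - ln (tan u))}.
Proof.
move=> t0 t4; apply: continuousN.
have [? _] := is_derive_ln_tan t0 t4.
exact/differentiable_continuous/derivable1_diffP.
Qed.

Lemma ln_tan_le0 (R : realType) (t : R) :
  0 < t -> t <= pi / 4 -> ln (tan t) <= 0.
Proof. by move=> t0 t4; have /andP[_ /ln_le0] := tan_quarter t0 t4. Qed.

Lemma is_derive_cot2 (R : realType) (t : R) : sin (2 * t) != 0 ->
  is_derive t 1 (fun u => cos (2 * u) / sin (2 * u)) (- 2 / sin (2 * t) ^+ 2).
Proof.
move=> s0; have ? := is_derive_sin2 t; have ? := is_derive_cos2 t.
have -> : (fun u : R => cos (2 * u) / sin (2 * u)) =
  (fun u : R => cos (2 * u)) * (fun u : R => (sin (2 * u))^-1) by apply/funext.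
have ? := is_deriveV s0 (is_derive_sin2 t).
apply: is_derive_eq; rewrite /GRing.scale/=.
have -> : cos (2 * t) * (- sin (2 * t) ^- 2 * (2 * cos (2 * t))) =
  - 2 * cos (2 * t) ^+ 2 / sin (2 * t) ^+ 2 by field.
by rewrite cos2sin2; field.
Qed.

(** The sum ln tan t + cot 2t has derivative 2 / sin 2t - 2 / (sin 2t)^2 <= 0
    and vanishes at pi / 4. *)
Lemma oppr_ln_tan_le_cot2 (R : realType) (t : R) : 0 < t -> t <= pi / 4 ->
  - ln (tan t) <= cos (2 * t) / sin (2 * t).
Proof.
move=> t0 t4.
pose h := @ln R \o tan + (fun u : R => cos (2 * u) / sin (2 * u)).
have h' u : t <= u -> u <= pi / 4 ->
    is_derive u 1 h (2 / sin (2 * u) - 2 / sin (2 * u) ^+ 2).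
  move=> tu u4; have u0 := lt_le_trans t0 tu.
  have [_ _ _ s0 _] := sin_cos_quarter u0 u4.
  have ? := is_derive_ln_tan u0 u4.
  have ? := is_derive_cot2 (lt0r_neq0 s0).
  by apply: is_derive_eq; rewrite mulNr.
suff : h (pi / 4) <= h t.
  rewrite /h !fctE /= tan_piquarter ln1 (_ : 2 * (pi / 4) = pi / 2); last lra.
  by rewrite cos_pihalf mul0r; lra.
apply: (@ler0_derive1_le_cc _ h t (pi / 4)) => //.
- by move=> u; rewrite in_itv/= => /andP[/ltW tu /ltW u4]; have [] := h' _ tu u4.
- move=> u; rewrite in_itv/= => /andP[/ltW tu /ltW u4].
  have [_] := h' _ tu u4; rewrite derive1E => ->.
  have [_ _ _ s0 _] := sin_cos_quarter (lt_le_trans t0 tu) u4.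
  have s1 := sin_le1 (2 * u).
  rewrite subr_le0 ler_pM2l// lef_pV2 ?posrE ?exprn_gt0//.
  by rewrite expr2 ler_piMr// ltW.
- apply: continuous_in_subspaceT => u; rewrite inE/= in_itv/= => /andP[tu u4].
  by have [? _] := h' _ tu u4; exact/differentiable_continuous/derivable1_diffP.
- by rewrite in_itv/= lexx andbT.
- by rewrite in_itv/= lexx.
Qed.

Lemma angle_sum_ge0 (R : realType) (n : nat) (t : R) :
  0 < t -> t <= pi / 4 -> 0 <= angle_sum n t.
Proof.
move=> t0 t4; have [_ _ _ s0 c0] := sin_cos_quarter t0 t4.
rewrite mulr_ge0// sumr_ge0// => k _.
by rewrite !mulr_ge0// ?exprn_ge0 ?ltW ?central_ratio_gt0.
Qed.

(** The derivative of 2t - G_n is 2 w_n s^(2n) >= 0, and G_n vanishes at 0. *)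
Lemma angle_sum_le (R : realType) (n : nat) (t : R) :
  0 < t -> t <= pi / 4 -> angle_sum n t <= 2 * t.
Proof.
move=> t0 t4.
pose h := 2 *: id - @angle_sum R n.
have h' (u : R) : is_derive u 1 h (2 * (central_ratio R n * sin (2 * u) ^+ (2 * n))).
  have ? := is_derive_angle_sum n u.
  by apply: is_derive_eq; rewrite /GRing.scale/=; lra.
have a0 : angle_sum n 0 = 0 :> R.
  by rewrite /angle_sum big1 ?mulr0// => k _; rewrite sin0 addn1 expr0n mulr0.
suff : h 0 <= h t.
  by rewrite /h !fctE /= a0 /GRing.scale /= mulr0 subr0 subr_ge0.
apply: (@ger0_derive1_le_cc _ h 0 t).
- by move=> u _; have [] := h' u.
- move=> u _; have [_] := h' u; rewrite derive1E => ->.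
  have w0 := central_ratio_gt0 R n.
  by rewrite mulr_ge0// mulr_ge0 ?(ltW w0)// exprM exprn_ge0// sqr_ge0.
- apply: continuous_in_subspaceT => u _.
  by have [? _] := h' u; exact/differentiable_continuous/derivable1_diffP.
- by rewrite in_itv/= lexx ltW.
- by rewrite in_itv/= lexx ltW.
- exact: ltW.
Qed.

Lemma tan_ge_id (R : realType) (t : R) : 0 < t -> t <= pi / 4 -> t <= tan t.
Proof.
move=> t0 t4.
have cn0 u : 0 <= u -> u <= t -> cos u != 0.
  move=> u0 ut; have [u2 uN2 _] := quarter_bounds u0 (le_trans ut t4).
  by apply/lt0r_neq0/cos_gt0_pihalf; rewrite u2 uN2.
have h' u : 0 <= u -> u <= t -> is_derive u 1 (@tan R - id) ((cos u) ^- 2 - 1).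
  move=> u0 ut; have ? := is_derive_tan (cn0 _ u0 ut); exact: is_derive_eq.
suff : (@tan R - id) 0 <= (@tan R - id) t by rewrite !fctE/= tan0; lra.
apply: (@ger0_derive1_le_cc _ (@tan R - id) 0 t).
- by move=> u; rewrite in_itv/= => /andP[/ltW u0 /ltW ut]; have [] := h' _ u0 ut.
- move=> u; rewrite in_itv/= => /andP[/ltW u0 /ltW ut].
  have [_] := h' _ u0 ut; rewrite derive1E => ->.
  by rewrite cos2_tan2 ?cn0// addrC addKr sqr_ge0.
- apply: continuous_in_subspaceT => u; rewrite inE/= in_itv/= => /andP[u0 ut].
  by have [? _] := h' _ u0 ut; exact/differentiable_continuous/derivable1_diffP.
- by rewrite in_itv/= lexx ltW.
- by rewrite in_itv/= lexx ltW.
- exact: ltW.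
Qed.

(** * Approximate primitives of ln tan *)

(** [upper_primitive] is U_n and [lower_primitive] is L_n: they are named after
    the side on which their derivatives lie from ln tan. *)
Definition upper_primitive (R : realType) (n : nat) (x : R) : R :=
  x * ln (tan x) - series (logtan_term x) n / 4.

Definition lower_primitive (R : realType) (n : nat) (x : R) : R :=
  angle_sum n x / 2 * ln (tan x) - series (logtan_term x) n / 4
  - central_ratio R n * sin (2 * x) ^+ (2 * n) / (4 * n%:R).

Lemma is_derive_upper_primitive (R : realType) (n : nat) (t : R) :
  0 < t -> t <= pi / 4 ->
  is_derive t 1 (upper_primitive n)
    (ln (tan t) + (2 * t - angle_sum n t) / sin (2 * t)).
Proof.
move=> t0 t4; have [_ _ _ /lt0r_neq0 s0 _] := sin_cos_quarter t0 t4.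
have -> : upper_primitive n =
    id * (@ln R \o tan) - 4^-1 *: (fun u => series (logtan_term u) n).
  by apply/funext => u; rewrite !fctE /upper_primitive /= [_ / 4]mulrC.
have ? := is_derive_ln_tan t0 t4; have ? := is_derive_logtan_series n s0.
apply: is_derive_eq; rewrite /GRing.scale /= mulr1.
by move: (ln _) (angle_sum _ _) => l g; field.
Qed.

Lemma is_derive_lower_primitive (R : realType) (n : nat) (t : R) :
  0 < t -> t <= pi / 4 ->
  is_derive t 1 (lower_primitive n.+1)
    (ln (tan t) - central_ratio R n.+1 * sin (2 * t) ^+ (2 * n).+1 *
      (cos (2 * t) + sin (2 * t) * ln (tan t))).
Proof.
move=> t0 t4; have [_ _ _ /lt0r_neq0 s0 _] := sin_cos_quarter t0 t4.
have -> : lower_primitive n.+1 =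
    (2^-1 *: @angle_sum R n.+1) * (@ln R \o tan)
    - 4^-1 *: (fun u => series (logtan_term u) n.+1)
    - (central_ratio R n.+1 / (4 * n.+1%:R)) *:
      (fun u => sin (2 * u) ^+ (2 * n.+1)).
  apply/funext => u; rewrite !fctE /lower_primitive /GRing.scale /=.
  by rewrite [_ / 2]mulrC [_ / 4]mulrC [_ * _ / (_ * _)]mulrAC.
have ? := is_derive_ln_tan t0 t4; have ? := is_derive_logtan_series n.+1 s0.
have ? := is_derive_angle_sum n.+1 t; have ? := is_derive_sin2X (2 * n.+1) t.
apply: is_derive_eq; rewrite /GRing.scale.
have -> : (2 * n.+1 = (2 * n).+2)%N by lia.
rewrite /=.
have -> : (2 * n).+2%:R = 2 * n.+1%:R :> R by rewrite -natrM; congr _%:R; lia.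
have : n.+1%:R != 0 :> R by rewrite pnatr_eq0.
rewrite /= exprS.
move: (n.+1%:R : R) (ln _) (angle_sum _ _) (central_ratio _ _) (_ ^+ _) => m l g w S m0.
by rewrite -[2^-1 *: g]/(2^-1 * g); field; rewrite s0 m0.
Qed.

Lemma upper_primitive_deriv_ge (R : realType) (n : nat) (t : R) :
  0 < t -> t <= pi / 4 ->
  ln (tan t) <= ln (tan t) + (2 * t - angle_sum n t) / sin (2 * t).
Proof.
move=> t0 t4; have [_ _ _ s0 _] := sin_cos_quarter t0 t4.
by rewrite lerDl divr_ge0 ?(ltW s0)// subr_ge0 angle_sum_le.
Qed.

Lemma lower_primitive_deriv_le (R : realType) (n : nat) (t : R) :
  0 < t -> t <= pi / 4 ->
  ln (tan t) - central_ratio R n.+1 * sin (2 * t) ^+ (2 * n).+1 *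
    (cos (2 * t) + sin (2 * t) * ln (tan t)) <= ln (tan t).
Proof.
move=> t0 t4; have [_ _ _ s0 _] := sin_cos_quarter t0 t4.
rewrite gerBl mulr_ge0//.
  by rewrite mulr_ge0 ?exprn_ge0 ?(ltW s0)// (ltW (central_ratio_gt0 R _)).
have := oppr_ln_tan_le_cot2 t0 t4; rewrite ler_pdivlMr// mulNr mulrC.
by move: (_ * ln _) => a; lra.
Qed.

Lemma logtan_series_ge0 (R : realType) (n : nat) (t : R) :
  0 < t -> t <= pi / 4 ->
  0 <= series (logtan_term t) n.
Proof.
move=> t0 t4; have [_ _ _ s0 _] := sin_cos_quarter t0 t4.
rewrite /series /= sumr_ge0// => k _; rewrite divr_ge0 ?mulr_ge0 ?exprn_ge0//.
by rewrite mulr_ge0// ltW.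
Qed.

Lemma lower_primitive_le0 (R : realType) (n : nat) (t : R) :
  0 < t -> t <= pi / 4 ->
  lower_primitive n t <= 0.
Proof.
move=> t0 t4; have [_ _ _ s0 _] := sin_cos_quarter t0 t4.
have S0 := logtan_series_ge0 n t0 t4.
have l0 : angle_sum n t / 2 * ln (tan t) <= 0.
  by rewrite mulr_ge0_le0 ?ln_tan_le0// divr_ge0 ?angle_sum_ge0.
have w0 : 0 <= central_ratio R n * sin (2 * t) ^+ (2 * n) / (4 * n%:R).
  by rewrite divr_ge0// mulr_ge0 ?exprn_ge0 ?(ltW s0)// ltW ?central_ratio_gt0.
by rewrite /lower_primitive; lra.
Qed.

(** The difference is (t - G_n / 2) ln tan t + w_n s^(2n) / (4n), whose first
    summand is nonpositive. *)
Lemma upper_sub_lower_le (R : realType) (n : nat) (t : R) :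
  0 < t -> t <= pi / 4 ->
  upper_primitive n t - lower_primitive n t <= central_ratio R n / (4 * n%:R).
Proof.
move=> t0 t4; have [_ _ _ s0 _] := sin_cos_quarter t0 t4.
have l0 : (t - angle_sum n t / 2) * ln (tan t) <= 0.
  rewrite mulr_ge0_le0 ?ln_tan_le0// subr_ge0 ler_pdivrMr// mulrC.
  exact: angle_sum_le.
have w0 : central_ratio R n * sin (2 * t) ^+ (2 * n) / (4 * n%:R) <=
    central_ratio R n / (4 * n%:R).
  have sn1 : sin (2 * t) ^+ (2 * n) <= 1 by rewrite exprn_ile1 ?(ltW s0) ?sin_le1.
  rewrite ler_wpM2r ?invr_ge0 ?mulr_ge0//.
  by rewrite ler_piMr// (ltW (central_ratio_gt0 R _)).
move: l0 w0; rewrite /upper_primitive /lower_primitive.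
move: (central_ratio _ _ * _ / _) (central_ratio _ _ / _) => a b.
by rewrite mulrBl; lra.
Qed.

Lemma logtan_series_cvg0 (R : realType) (n : nat) :
  series (logtan_term t) n @[t --> (0 : R)] --> (0 : R).
Proof.
elim: n => [|n IH].
  by rewrite (_ : (fun t => _) = cst 0); [exact: cvg_cst|
    apply/funext => t; rewrite /series /= big_geq].
rewrite (_ : (fun t => _) = (fun t => series (logtan_term t) n +
    2 * (central_ratio R n / (2 * n + 1)%:R ^+ 2) * sin (2 * t) ^+ (2 * n + 1))).
  rewrite -[X in _ --> X]addr0; apply: cvgD => //.
  rewrite -[X in _ --> X](mulr0 (2 * (central_ratio R n / (2 * n + 1)%:R ^+ 2))).
  apply: cvgM; first exact: cvg_cst.
  have [d _] := is_derive_sin2X (2 * n + 1) (0 : R).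
  have s0 : sin (2 * (0 : R)) ^+ (2 * n + 1) = 0.
    by rewrite mulr0 sin0 expr0n addn1.
  rewrite -[X in _ --> X]s0.
  suff : {for (0 : R), continuous (fun t : R => sin (2 * t) ^+ (2 * n + 1))} by [].
  by apply/differentiable_continuous/derivable1_diffP.
by apply/funext => t; rewrite /series /= big_nat_recr//= logtan_termE.
Qed.

(** With h = sqrt (tan t), - ln tan t = 2 ln (1 / h) <= 2 / h, and t <= h^2, so
    0 <= - t ln tan t <= 2 h. *)
Lemma idM_ln_tan_cvg0 (R : realType) :
  t * ln (tan t) @[t --> (0 : R)^'+] --> (0 : R).
Proof.
have pi0 : 0 < pi / 4 :> R by rewrite divr_gt0 ?pi_gt0.
have cs : - (2 * Num.sqrt (tan t)) @[t --> (0 : R)^'+] --> (0 : R).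
  apply: cvg_at_right_filter.
  have ct : {for (0 : R), continuous (@Num.sqrt R \o @tan R)}.
    apply: continuous_comp; first by apply: continuous_tan; rewrite cos0.
    exact: sqrt_continuous.
  rewrite -[X in _ --> X](_ : - (2 * Num.sqrt (tan 0)) = 0); last first.
    by rewrite tan0 sqrtr0 mulr0 oppr0.
  by apply: cvgN; apply: cvgM; [exact: cvg_cst|exact: ct].
apply: (squeeze_cvgr _ cs); last exact: cvg_cst.
near=> t.
have t0 : 0 < t by [].
have t4 : t <= pi / 4 by near: t; exact: nbhs_right_le.
have /andP[tan0 _] := tan_quarter t0 t4.
have l0 := ln_tan_le0 t0 t4.
rewrite mulr_ge0_le0 ?(ltW t0)// andbT.
set h := Num.sqrt (tan t).
have h0 : 0 < h by rewrite sqrtr_gt0.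
have hh : tan t = h ^+ 2 by rewrite sqr_sqrtr// ltW.
have th := tan_ge_id t0 t4.
have hV : 0 < h^-1 by rewrite invr_gt0.
have := ln_sublinear hV; rewrite lnV ?posrE// => lh.
rewrite hh in th *; rewrite lnXn// -mulr_natl.
rewrite -subr_ge0.
have : 0 <= t * (h^-1 + ln h) by rewrite mulr_ge0 ?(ltW t0)//; lra.
have : t * h^-1 <= h by rewrite ler_pdivrMr// -expr2.
by rewrite mulrDr; move: (ln h) (t * h^-1) => l p; lra.
Unshelve. all: end_near. Qed.

Lemma upper_primitive_cvg0 (R : realType) (n : nat) :
  upper_primitive n t @[t --> (0 : R)^'+] --> (0 : R).
Proof.
rewrite -[X in _ --> X]subr0 -[X in _ - X](mul0r 4^-1).
apply: cvgB; first exact: idM_ln_tan_cvg0.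
apply: cvgM; last exact: cvg_cst.
by apply: cvg_at_right_filter; exact: logtan_series_cvg0.
Qed.

(** * The integral of ln tan and the convergence of the series *)

Lemma itv_quarter (R : realType) (x t : R) : x <= pi / 4 -> t \in `]0, x] ->
  0 < t /\ t <= pi / 4.
Proof. by move=> x4; rewrite in_itv/= => /andP[-> tx]; rewrite (le_trans tx). Qed.

(** The integral bounds are stated for - ln tan, which is nonnegative on
    [0, pi / 4]. *)
Lemma Nln_tan_integral_le (R : realType) (n : nat) (x : R) :
  0 < x -> x <= pi / 4 ->
  (@lebesgue_measure R).-integrable `[0, x] (EFin \o (fun t => - ln (tan t))) /\
  \int[@lebesgue_measure R]_(t in `[0, x]) (- ln (tan t))
    <= - lower_primitive n.+1 x.
Proof.
move=> x0 x4.
apply: (@improper_Rintegral_le _ _ (\- lower_primitive n.+1) (fun t =>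
    - (ln (tan t) - central_ratio R n.+1 * sin (2 * t) ^+ (2 * n).+1 *
      (cos (2 * t) + sin (2 * t) * ln (tan t))))) => // t /(itv_quarter x4)[t0 t4].
- exact: ln_tan_continuous.
- by rewrite oppr_ge0 ln_tan_le0.
- by have ? := is_derive_lower_primitive n t0 t4; exact: is_deriveN.
- by rewrite lerN2 lower_primitive_deriv_le.
- by rewrite oppr_ge0 lower_primitive_le0.
Qed.

Lemma Nln_tan_integral_ge (R : realType) (n : nat) (x : R) :
  0 < x -> x <= pi / 4 ->
  - upper_primitive n x
    <= \int[@lebesgue_measure R]_(t in `[0, x]) (- ln (tan t)).
Proof.
move=> x0 x4.
apply: (@le_improper_Rintegral _ _ (\- upper_primitive n) (fun t =>
    - (ln (tan t) + (2 * t - angle_sum n t) / sin (2 * t)))) => //.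
- exact: (Nln_tan_integral_le 0 x0 x4).1.
- by move=> t /(itv_quarter x4)[t0 t4]; exact: ln_tan_continuous.
- move=> t; rewrite in_itv/= le_eqVlt => /andP[/predU1P[<- _|t0 tx]].
    (* At t = 0 the tangent is 0, and the total logarithm takes the value 0. *)
    by rewrite tan0 ln0 ?oppr0.
  by rewrite oppr_ge0 ln_tan_le0// (le_trans tx).
- move=> t /(itv_quarter x4)[t0 t4].
  by have ? := is_derive_upper_primitive n t0 t4; exact: is_deriveN.
- by move=> t /(itv_quarter x4)[t0 t4]; rewrite lerN2 upper_primitive_deriv_ge.
- by rewrite -[X in _ --> X]oppr0; apply: cvgN; exact: upper_primitive_cvg0.
Qed.

(** It suffices to treat the largest interval: integrability on [0, x], the
    degenerate case x = 0 included, follows by restriction. *)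
Lemma ln_tan_integrable (R : realType) :
  (@lebesgue_measure R).-integrable `[0, pi / 4] (EFin \o (fun t => ln (tan t))).
Proof.
have pi0 : 0 < pi / 4 :> R by rewrite divr_gt0 ?pi_gt0.
have [Ni _] := Nln_tan_integral_le 0 pi0 (lexx _).
rewrite (_ : EFin \o _ = (\- (EFin \o (fun t : R => - ln (tan t))%R))%E).
  exact: integrableN.
by apply/funext => t; rewrite /= opprK.
Qed.

(** The middle term is 4 (U_(n+1) - int_0^x ln tan), which lies between 0 and
    4 (U_(n+1) - L_(n+1)). *)
Lemma logtan_series_error (R : realType) (n : nat) (x : R) :
  0 <= x -> x <= pi / 4 ->
  0 <= 4 * (x * ln (tan x) - \int[@lebesgue_measure R]_(t in `[0, x]) ln (tan t))
     - series (logtan_term x) n.+1 <= central_ratio R n.+1 / n.+1%:R.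
Proof.
rewrite le_eqVlt => /predU1P[<- _|x0 x4].
  rewrite set_itv1 Rintegral_set1 mul0r subr0 mulr0 /series /= big1 => [|k _].
    by rewrite subr0 lexx divr_ge0// ltW ?central_ratio_gt0.
  by rewrite /logtan_term mulr0 sin0 mulr0 addn1 expr0n mul0r.
have fi : (@lebesgue_measure R).-integrable `[0, x] (EFin \o (fun t => ln (tan t))).
  apply: integrableS (ln_tan_integrable R) => //.
  by apply: subset_itvl; rewrite bnd_simp.
have IN : \int[@lebesgue_measure R]_(t in `[0, x]) (- ln (tan t)) =
    - \int[@lebesgue_measure R]_(t in `[0, x]) ln (tan t).
  rewrite -mulN1r -RintegralZl//.
  by apply: eq_Rintegral => t _; rewrite mulN1r.
have := (Nln_tan_integral_le n x0 x4).2; have := Nln_tan_integral_ge n.+1 x0 x4.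
rewrite IN !lerN2; move: (Rintegral _ _ _) => I.
have := upper_sub_lower_le n.+1 x0 x4.
have -> : central_ratio R n.+1 / n.+1%:R = 4 * (central_ratio R n.+1 / (4 * n.+1%:R)).
  by field; rewrite nat1r pnatr_eq0.
move: (central_ratio R n.+1 / _) => w UL IU LI.
move: UL IU LI; rewrite /upper_primitive.
move: (lower_primitive _ _) => L.
move: (x * ln _) (series _ _) => l S UL IU LI.
by apply/andP; split; lra.
Qed.

Theorem theorem2 (R : realType) (x : R) (hx0 : 0 <= x) (hx1 : x <= pi / 4) :
  [/\ (@lebesgue_measure R).-integrable `[0, x]
        (fun t : R => (ln (tan t))%:E),
      cvgn (series (logtan_term x)) &
      \int[@lebesgue_measure R]_(t in `[0, x]) ln (tan t) =
        x * ln (tan x) - 1 / 4 * limn (series (logtan_term x))].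
Proof.
set I := Rintegral _ _ _.
pose c := 4 * (x * ln (tan x) - I).
have Sc : series (logtan_term x) n @[n --> \oo] --> c.
  rewrite -(cvg_shiftS (series (logtan_term x))) -(subr0 c).
  rewrite (_ : (fun n => _) =
      (fun n => c - (c - series (logtan_term x) n.+1))); last first.
    by apply/funext => n; rewrite opprB addrC subrK.
  apply: cvgB; first exact: cvg_cst.
  apply: (squeeze_cvgr _ (cvg_cst 0) (@central_ratio_cvg0 R)); apply: nearW => n.
  exact: logtan_series_error.
split.
- apply: integrableS (ln_tan_integrable R) => //.
  by apply: subset_itvl; rewrite bnd_simp.
- by apply/cvg_ex; exists c.
- by rewrite (cvg_lim _ Sc)// /c; move: (x * _) => a; lra.
Qed.
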